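(* Let $G$ be a (discrete) group generated by a finite set $S=\{g_1,\dots,g_n\}$ and let $\pi$ be a unitary representation of $G$. Then $1_G\prec\pi$ if and only if $H_0\subset p(A_\pi)$, where $H_0=\{z\in\mathbb{P}^n\mid z_0+z_1+\cdots+z_n=0\}$ and $A_\pi(z)=z_0I+z_1\pi(g_1)+\cdots+z_n\pi(g_n)$.
   Context: $1_G$ denotes the trivial (one-dimensional) representation of $G$. For unitary representations $(\pi,\mathcal{H})$ and $(\rho,\mathcal{K})$ of a discrete group $G$, $\pi$ is weakly contained in $\rho$, written $\pi\prec\rho$, if for every $x\in\mathcal{H}$, every finite subset $F\subset G$ and every $\epsilon>0$ there exist $y_1,\dots,y_m\in\mathcal{K}$ such that $|\langle\pi(g)x,x\rangle-\sum_{i=1}^m\langle\rho(g)y_i,y_i\rangle|<\epsilon$ for all $g\in F$. The projective spectrum $p(A_\pi)$ is the set of $z=[z_0:\cdots:z_n]$ in complex projective space $\mathbb{P}^n$ such that $A_\pi(z)$ is not invertible in the algebra of bounded operators on the representation space. *)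

(* Defs.v *)
From HB Require Import structures.
From mathcomp Require Import all_boot all_order all_algebra.
From mathcomp Require Import sesquilinear complex.
From mathcomp Require Import all_classical reals topology normedtype.

Set Implicit Arguments.
Unset Strict Implicit.
Unset Printing Implicit Defensive.

Import Order.TTheory GRing.Theory Num.Theory.
Import numFieldNormedType.Exports.

Local Open Scope classical_set_scope.
Local Open Scope ring_scope.
Local Open Scope complex_scope.

(* Complex Hilbert spaces. The inner product is linear in its first argument
   and conjugate-linear in its second one. *)
HB.mixin Record CompleteNormedModule_isHilbert (R : realType) H
    & CompleteNormedModule R[i] H := {
  inner : {dot H for Num.conj};
  inner_norm : forall x : H, inner x x = `|x| ^+ 2
}.

#[short(type="hilbertType")]
HB.structure Definition Hilbert (R : realType) :=
  {H of CompleteNormedModule R[i] H & CompleteNormedModule_isHilbert R H}.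

Section complex_line.
Variable R : realType.

HB.instance Definition _ := NormedModule.copy R[i] (R[i])^o.

Lemma normc_Re_le (z : R[i]) (e : R) : `|z| < e%:C -> `|complex.Re z| < e.
Proof.
rewrite normc_def ltcR; apply: le_lt_trans.
by rewrite -sqrtr_sqr ler_wsqrtr// lerDl sqr_ge0.
Qed.

Lemma normc_Im_le (z : R[i]) (e : R) : `|z| < e%:C -> `|complex.Im z| < e.
Proof.
rewrite normc_def ltcR; apply: le_lt_trans.
by rewrite -sqrtr_sqr ler_wsqrtr// lerDr sqr_ge0.
Qed.

Lemma normc_le_ReIm (z : R[i]) : `|z| <= (`|complex.Re z| + `|complex.Im z|)%:C.
Proof.
rewrite normc_def lecR -[leRHS]ger0_norm ?addr_ge0// -sqrtr_sqr.
rewrite ler_wsqrtr// sqrrD -!normrX !(ger0_norm (sqr_ge0 _)) addrAC.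
by rewrite lerDl mulrn_wge0// mulr_ge0.
Qed.

Lemma complex_complete (F : set_system R[i]) :
  ProperFilter F -> cauchy F -> cvg F.
Proof.
move=> FF /cauchyP Fc.
have cvgcomp (f : R[i] -> R) : {morph f : x y / x - y} ->
    (forall z (e : R), `|z| < e%:C -> `|f z| < e) -> cvg (f @ F).
  move=> fB fle; apply/cauchy_cvgP/cauchyP => e e0.
  have [z zF] : exists z, F (ball z e%:C) by apply: Fc; rewrite ltcR.
  exists (f z); suff: F (f @^-1` ball (f z) e) by [].
  by apply: filterS zF => w; rewrite -!ball_normE/= => /fle; rewrite fB.
have ReB : {morph @complex.Re R : x y / x - y} by move=> [? ?] [? ?].
have ImB : {morph @complex.Im R : x y / x - y} by move=> [? ?] [? ?].
have cRe := cvgcomp _ ReB normc_Re_le; have cIm := cvgcomp _ ImB normc_Im_le.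
apply/cvg_ex; exists (lim (@complex.Re R @ F) +i* lim (@complex.Im R @ F)).
apply/cvgrPdist_lt => -[e e']; rewrite ltcE/= => /andP[/eqP-> e0].
near=> z; apply: le_lt_trans (normc_le_ReIm _) _.
rewrite ltcR (splitr e) ReB ImB/=.
by apply: ltrD; near: z; apply: cvgr_dist_lt; rewrite ?divr_gt0.
Unshelve. all: by end_near. Qed.

HB.instance Definition _ := Uniform_isComplete.Build R[i] complex_complete.

Definition complex_inner (x y : R[i]) : R[i] := x * Num.conj y.

Lemma complex_inner_bilinear :
  bilinear_for *%R (Num.conj \; *%R) complex_inner.
Proof.
split=> u a x y; rewrite /complex_inner.
  by rewrite mulrDl -mulrA.
by rewrite rmorphD rmorphM mulrDr mulrCA.
Qed.

HB.instance Definition _ := bilinear_isBilinear.Build R[i] R[i] R[i] R[i]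
  *%R (Num.conj \; *%R) complex_inner complex_inner_bilinear.

Lemma complex_inner_hermitian x y :
  complex_inner x y = (-1) ^+ false * Num.conj (complex_inner y x).
Proof. by rewrite /= expr0 mul1r /complex_inner rmorphM/= conjCK mulrC. Qed.

HB.instance Definition _ := isHermitianSesquilinear.Build R[i] R[i]
  false Num.conj complex_inner complex_inner_hermitian.

Lemma complex_inner_gt0 x : x != 0 -> 0 < complex_inner x x.
Proof. by move=> x0; rewrite /complex_inner -normCK exprn_gt0// normr_gt0. Qed.

HB.instance Definition _ := isDotProduct.Build R[i] R[i]
  complex_inner complex_inner_gt0.

Lemma complex_inner_norm x : complex_inner x x = `|x| ^+ 2.
Proof. by rewrite normCK. Qed.

HB.instance Definition _ :=
  CompleteNormedModule_isHilbert.Build R R[i] complex_inner_norm.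

End complex_line.

Section operators.
Variables (R : realType) (H : hilbertType R).
Implicit Types T U : H -> H.

Definition bounded_operator T :=
  linear T /\ exists M : R, forall x, `|T x| <= M%:C * `|x|.

(* Invertibility in the algebra of bounded operators: the inverse is required
   to be a bounded operator. *)
Definition invertible_operator T :=
  exists S : H -> H, [/\ bounded_operator S, cancel T S & cancel S T].

Definition unitary_operator U :=
  [/\ linear U, forall x y, inner (U x) (U y) = inner x y
    & forall y, exists x, U x = y].

Lemma unitary_norm U : unitary_operator U -> forall x, `|U x| = `|x|.
Proof.
move=> [_ Ui _] x; apply/eqP.
by rewrite -(@eqrXn2 _ 2)// -!inner_norm Ui.
Qed.

Lemma unitary_bounded U : unitary_operator U -> bounded_operator U.
Proof.
move=> Uu; have [Ul _ _] := Uu; split=> //.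
by exists 1 => x; rewrite mul1r unitary_norm.
Qed.

End operators.

Record unitary_rep (R : realType) (G : groupType) (H : hilbertType R) := {
  rep_fun :> G -> H -> H;
  rep_unitary : forall g, unitary_operator (rep_fun g);
  rep1 : forall x, rep_fun 1%g x = x;
  repM : forall g h x, rep_fun (g * h)%g x = rep_fun g (rep_fun h x)
}.

Section trivial_rep.
Variables (R : realType) (G : groupType).

Lemma trivial_rep_unitary (g : G) : unitary_operator (idfun : R[i] -> R[i]).
Proof. by split=> // y; exists y. Qed.

Definition trivial_rep : unitary_rep G R[i] :=
  {| rep_fun := fun _ => idfun; rep_unitary := trivial_rep_unitary;
     rep1 := fun=> erefl; repM := fun _ _ _ => erefl |}.

End trivial_rep.

Definition weakly_contained (R : realType) (G : groupType)
    (H K : hilbertType R) (pi : unitary_rep G H) (rho : unitary_rep G K) :=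
  forall (x : H) (F : set G) (e : R), finite_set F -> 0 < e ->
  exists (m : nat) (y : 'I_m -> K), forall g, F g ->
    `|inner (pi g x) x - \sum_i inner (rho g (y i)) (y i)| < e%:C.

Definition generates (G : groupType) (S : set G) :=
  smallest [set K : set G | group_closed (mem K)] S = [set: G].

Section projective_space.
Variables (R : realType) (n : nat).

(* The complex projective space P^n, as the set of lines through the origin
   of C^(n+1). *)
Definition proj_space := {L : {vspace 'rV[R[i]]_n.+1} | \dim L == 1%N}.

Lemma dim_vline1 (z : 'rV[R[i]]_n.+1) : z != 0 -> \dim <[z]> == 1%N.
Proof. by move=> z0; rewrite dim_vline z0. Qed.

(* The point [z_0 : ... : z_n] *)
Definition proj_point (z : 'rV[R[i]]_n.+1) (z0 : z != 0) : proj_space :=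
  exist _ <[z]>%VS (dim_vline1 z0).

(* The hyperplane H_0 : z_0 + z_1 + ... + z_n = 0 *)
Definition sum0_hyperplane : set proj_space :=
  [set p | exists (z : 'rV[R[i]]_n.+1) (z0 : z != 0),
    p = proj_point z0 /\ \sum_i z 0 i = 0].

Definition proj_spectrum (H : hilbertType R) (A : 'rV[R[i]]_n.+1 -> H -> H) :
    set proj_space :=
  [set p | exists (z : 'rV[R[i]]_n.+1) (z0 : z != 0),
    p = proj_point z0 /\ ~ invertible_operator (A z)].

Lemma proj_point_eq (z w : 'rV[R[i]]_n.+1) (z0 : z != 0) (w0 : w != 0) :
  proj_point z0 = proj_point w0 -> exists2 c, c != 0 & z = c *: w.
Proof.
move=> /(congr1 val)/= zw.
have /vlineP[c zE] : z \in <[w]>%VS by rewrite -zw memv_line.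
exists c => //; apply: contraNneq z0 => c0.
by rewrite zE c0 scale0r.
Qed.

End projective_space.

Arguments sum0_hyperplane : clear implicits.

Section pencil.
Variables (R : realType) (n : nat) (G : groupType) (H : hilbertType R).
Variables (pi : unitary_rep G H) (g : 'I_n -> G).

(* A_pi(z) = z_0 I + z_1 pi(g_1) + ... + z_n pi(g_n); the generator g_i is
   g (i - 1), with ordinals counted from 0, and lift ord0 is i |-> i + 1. *)
Definition pencil (z : 'rV[R[i]]_n.+1) (x : H) : H :=
  z 0 ord0 *: x + \sum_(i < n) z 0 (lift ord0 i) *: pi (g i) x.

Lemma pencil_bounded z : bounded_operator (pencil z).
Proof.
split=> [a x y|].
  rewrite /pencil [a *: (_ + _)]scalerDr scaler_sumr addrACA -big_split/=.
  congr (_ + _); first by rewrite scalerDr !scalerA mulrC.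
  apply: eq_bigr => i _; have [-> _ _] := rep_unitary pi (g i).
  by rewrite scalerDr !scalerA mulrC.
exists (\sum_i complex.Re `|z 0 i|) => x.
rewrite rmorph_sum/= mulr_suml big_ord_recl/=.
have nE (c : R[i]) : (complex.Re `|c|)%:C = `|c| by rewrite normc_def.
apply: le_trans (ler_normD _ _) _; rewrite normrZ nE lerD2l.
apply: le_trans (ler_norm_sum _ _ _) _; apply: ler_sum => i _.
by rewrite normrZ nE unitary_norm//; exact: rep_unitary.
Qed.

Lemma pencilZ c z x : pencil (c *: z) x = c *: pencil z x.
Proof.
rewrite /pencil scalerDr scaler_sumr mxE scalerA; congr (_ + _).
by apply: eq_bigr => i _; rewrite mxE scalerA.
Qed.

Lemma invertible_pencilZ c z : c != 0 -> invertible_operator (pencil z) ->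
  invertible_operator (pencil (c *: z)).
Proof.
move=> c0 [S [[Sl [M SM]] zS Sz]].
have SZ a x : S (a *: x) = a *: S x.
  have S0 : S 0 = 0 by have := Sl (-1) 0 0; rewrite scaler0 addr0 scaleN1r addNr.
  by have := Sl a x 0; rewrite S0 !addr0.
exists (fun x => c^-1 *: S x); split.
- split=> [a x y|].
    by rewrite Sl scalerDr !scalerA mulrC.
  exists (complex.Re `|c^-1| * M) => x; rewrite normrZ rmorphM/= -mulrA.
  have -> : (complex.Re `|c^-1|)%:C = `|c^-1| by rewrite normc_def.
  by rewrite ler_wpM2l.
- by move=> x; rewrite pencilZ SZ scalerA mulVf// scale1r zS.
- by move=> x; rewrite pencilZ -SZ Sz scalerA mulfV// scale1r.
Qed.

Lemma proj_spectrum_pencilP z (z0 : z != 0) :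
  proj_spectrum pencil (proj_point z0) <-> ~ invertible_operator (pencil z).
Proof.
split=> [[w [w0 [/proj_point_eq[c c0 ->] Nw]]]|Nz]; last by exists z, z0.
move=> /(@invertible_pencilZ c^-1); rewrite scalerA mulVf// scale1r => Iw.
by apply/Nw/Iw; rewrite invr_eq0.
Qed.

End pencil.

(* Main.v *)
Require Import Defs.
From mathcomp Require Import all_boot all_order all_algebra.
From mathcomp Require Import sesquilinear complex.
From mathcomp Require Import all_classical reals topology normedtype.
From mathcomp Require Import sequences ring lra.

(** Put [Q y = \sum_k |pi (g_k) y - y| ^ 2]. On [H_0] the pencil is
    [A y = \sum_k z_k (pi (g_k) y - y)], so [|A y| ^ 2 <= K Q y]. If [1_G] is
    weakly contained in [pi], there are finite families [y_i] with
    [\sum_i |y_i| ^ 2] close to [1] and [\sum_i Q y_i] arbitrarily small, so [A]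
    is not bounded below.

    Conversely, at the point [n : -1 : ... : -1] of [H_0],
    [Re <A y, y> = Q y / 2]. If [Q y >= e |y| ^ 2] for all [y], then [A] would be
    coercive, hence invertible by Lax-Milgram. So [Q] takes arbitrarily small
    values on unit vectors; since the [h] such that
    [|pi h y - y| ^ 2 <= C Q y] for some [C] and all [y] form a subgroup
    containing the generators, such vectors are almost invariant under every
    finite subset of [G]. *)

Import Order.TTheory GRing.Theory Num.Theory.
Import numFieldNormedType.Exports.

Local Open Scope classical_set_scope.
Local Open Scope ring_scope.
Local Open Scope complex_scope.

(** * Real-valued inner product estimates *)

Section inner_product.
Context {R : realType} {H : hilbertType R}.
Implicit Types x y : H.

(** Taking values in [R] keeps the estimates in a totally ordered field, where [lra] applies. *)
Definition rinner x y : R := complex.Re (inner x y).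
Definition sqnorm x : R := rinner x x.

Lemma ReD : {morph @complex.Re R : z w / z + w}.
Proof. by move=> [? ?] [? ?]. Qed.

Lemma ReN : {morph @complex.Re R : z / - z}.
Proof. by case. Qed.

Lemma Re_sum I (r : seq I) (P : pred I) (F : I -> R[i]) :
  complex.Re (\sum_(i <- r | P i) F i) = \sum_(i <- r | P i) complex.Re (F i).
Proof. exact: (big_morph _ ReD). Qed.

Lemma innerDl x y z : inner (x + y) z = inner x z + inner y z.
Proof. exact: linearDl. Qed.

Lemma innerBl x y z : inner (x - y) z = inner x z - inner y z.
Proof. exact: linearBl. Qed.

Lemma innerZl a x y : inner (a *: x) y = a * inner x y.
Proof. exact: linearZl_LR. Qed.

Lemma innerC x y : inner x y = Num.conj (inner y x).
Proof. by rewrite (@hermC _ _ _ _ inner)/= expr0 mul1r. Qed.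

Lemma inner_sqnorm x : inner x x = (sqnorm x)%:C.
Proof.
by rewrite /sqnorm /rinner inner_norm RRe_real// rpredX// normr_real.
Qed.

Lemma rinnerC x y : rinner x y = rinner y x.
Proof. by rewrite /rinner innerC; case: (inner y x). Qed.

Lemma rinnerDl x y z : rinner (x + y) z = rinner x z + rinner y z.
Proof. by rewrite /rinner innerDl ReD. Qed.

Lemma rinner_suml I (r : seq I) (P : pred I) (F : I -> H) y :
  rinner (\sum_(i <- r | P i) F i) y = \sum_(i <- r | P i) rinner (F i) y.
Proof.
apply: (big_morph (rinner^~ y)) => [u v|]; first exact: rinnerDl.
by rewrite /rinner -(subrr 0) innerBl subrr.
Qed.

Lemma rinnerDr x y z : rinner x (y + z) = rinner x y + rinner x z.
Proof. by rewrite rinnerC rinnerDl !(rinnerC x). Qed.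

Lemma rinnerZl (a : R) x y : rinner (a%:C *: x) y = a * rinner x y.
Proof.
by rewrite /rinner innerZl; case: (inner x y) => u v /=; rewrite mul0r subr0.
Qed.

Lemma rinnerZr (a : R) x y : rinner x (a%:C *: y) = a * rinner x y.
Proof. by rewrite rinnerC rinnerZl rinnerC. Qed.

Lemma rinnerNl x y : rinner (- x) y = - rinner x y.
Proof. by rewrite -scaleN1r -(rmorphN1 (real_complex R)) rinnerZl mulN1r. Qed.

Lemma rinnerNr x y : rinner x (- y) = - rinner x y.
Proof. by rewrite rinnerC rinnerNl rinnerC. Qed.

Definition rinnerE :=
  (rinnerDl, rinnerDr, rinnerNl, rinnerNr, rinnerZl, rinnerZr).

Lemma sqnormE x : (sqnorm x)%:C = `|x| ^+ 2.
Proof. by rewrite -inner_sqnorm inner_norm. Qed.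

Lemma sqnorm_ge0 x : 0 <= sqnorm x.
Proof. by rewrite -lecR sqnormE exprn_ge0. Qed.

Lemma sqnorm_eq0 x : (sqnorm x == 0) = (x == 0).
Proof. by rewrite -(inj_eq (@complexI R)) sqnormE sqrf_eq0 normr_eq0. Qed.

Lemma sqnormZ a x : sqnorm (a *: x) = complex.Re (`|a| ^+ 2) * sqnorm x.
Proof.
apply: (@complexI R); rewrite rmorphM [LHS]sqnormE normrZ exprMn -sqnormE.
by congr (_ * _); apply/esym/RRe_real; rewrite rpredX// normr_real.
Qed.

Lemma sqnormN x : sqnorm (- x) = sqnorm x.
Proof. by rewrite /sqnorm !rinnerE opprK. Qed.

Lemma sqnormD x y : sqnorm (x + y) = sqnorm x + 2 * rinner x y + sqnorm y.
Proof. by rewrite /sqnorm !rinnerE (rinnerC y x); ring. Qed.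

Lemma sqnormD_le x y : sqnorm (x + y) <= 2 * (sqnorm x + sqnorm y).
Proof.
by have := sqnorm_ge0 (x - y); rewrite !sqnormD sqnormN !rinnerE; lra.
Qed.

(** Iterating [sqnormD_le] costs a factor 2 per summand; the crude constant is harmless, being
    independent of [v]. *)
Lemma sqnorm_sum_le n (v : 'I_n -> H) :
  sqnorm (\sum_i v i) <= 2 ^+ n * \sum_i sqnorm (v i).
Proof.
elim: n v => [|n IH] v.
  by rewrite !big_ord0 mulr0 le_eqVlt sqnorm_eq0 eqxx.
rewrite !big_ord_recl; apply: le_trans (sqnormD_le _ _) _.
rewrite exprS -mulrA ler_pM2l// mulrDr lerD//.
by rewrite ler_peMl ?sqnorm_ge0// exprn_ege1// ler1n.
Qed.

(** Expand [sqnorm (t x + y) >= 0] and [sqnorm (t x - y) >= 0]. The free weight [t] lets this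
    replace Cauchy-Schwarz. *)
Lemma rinner_le (t : R) x y : 0 < t ->
  2 * `|rinner x y| <= t * sqnorm x + t^-1 * sqnorm y.
Proof.
move=> t0.
have := sqnorm_ge0 (t%:C *: x + y); have := sqnorm_ge0 (t%:C *: x - y).
rewrite !sqnormD sqnormN !rinnerE {1 3}/sqnorm !rinnerE -/(sqnorm x) => h1 h2.
rewrite -(ler_pM2l t0) mulrDr mulVKf ?gt_eqF//.
by case: (ger0P (rinner x y)) => _; lra.
Qed.

Lemma inner_le (t : R) x y : 0 < t ->
  `|inner x y| <= (t * sqnorm x + t^-1 * sqnorm y)%:C.
Proof.
move=> t0; apply: le_trans (normc_le_ReIm _) _; rewrite lecR.
(* Replacing [x] by [i x] turns the imaginary part into a real part, so [rinner_le] bounds both. *)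
have Rei z : complex.Re ((0 +i* 1) * z) = - complex.Im z :> R.
  by case: z => a b /=; rewrite mul0r mul1r sub0r.
have sqi : sqnorm ((0 +i* 1) *: x) = sqnorm x.
  rewrite sqnormZ -add_Re2_Im2 [complex.Re _]/=.
  by rewrite expr0n expr1n add0r mul1r.
have := rinner_le _ x y t0; have := rinner_le _ ((0 +i* 1) *: x) y t0.
rewrite sqi {1}/rinner innerZl Rei normrN /rinner.
lra.
Qed.

Lemma norm_sqnorm_le (a : R) x y : 0 <= a ->
  (`|x| <= a%:C * `|y|) = (sqnorm x <= a ^+ 2 * sqnorm y).
Proof.
move=> a0; rewrite -lecR rmorphM rmorphXn/= !sqnormE -exprMn.
by rewrite ler_sqr ?nnegrE ?mulr_ge0 ?lecR.
Qed.

End inner_product.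

(** * Banach fixed point theorem *)

Section contraction.
Context {R : realType} {X : completeNormedModType R[i]}.

Lemma contraction_fixpoint (f : X -> X) (q : R) : 0 <= q < 1 ->
  (forall x y, `|f x - f y| <= q%:C * `|x - y|) -> exists p, f p = p.
Proof.
move=> /andP[q0 q1] fq; pose u n := iter n f 0.
(* [c] solves [c = q c + |f 0|], so [f] maps the closed ball of radius [c] around 0 into itself and
   all iterates of 0 stay there. *)
pose c : R[i] := `|f 0| / (1 - q)%:C.
have c0 : 0 <= c by rewrite divr_ge0// lecR subr_ge0 ltW.
have uC n : `|u n - 0| <= c.
  elim: n => [|n IH]; first by rewrite subrr normr0.
  have -> : u n.+1 - 0 = (f (u n) - f 0) + (f 0) by rewrite subrK subr0.
  apply: le_trans (ler_normD _ _) _.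
  have -> : c = q%:C * c + `|f 0|.
    have q1' : (1 - q)%:C != 0 :> R[i].
      rewrite -(rmorph0 (real_complex R)) (inj_eq (@complexI R)).
      by rewrite subr_eq0 gt_eqF.
    apply/eqP; rewrite -subr_eq0 opprD addrA -{1}(mul1r c) -mulrBl.
    by rewrite -(rmorph1 (real_complex R)) -rmorphB mulrC divfK// subrr.
  by rewrite lerD2r; apply: le_trans (fq _ _) _; rewrite ler_wpM2l// lecR.
have uD n m : `|u n - u (n + m)%N| <= (q ^+ n)%:C * c.
  elim: n => [|n IH]; first by rewrite distrC mul1r.
  rewrite addSn; apply: le_trans (fq _ _) _.
  by rewrite exprS rmorphM/= -mulrA ler_wpM2l// lecR.
have cE : c = (complex.Re c)%:C by rewrite RRe_real// ger0_real.
have /cvg_ex[p up] : cvg (u @ \oo).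
  apply: cauchy_cvg; apply/cauchyP => e; rewrite ltcE/= => /andP[/eqP ei er].
  have [N _ /(_ N (leqnn N))/= hN] : \forall n \near \oo,
      q ^+ n * complex.Re c < complex.Re e.
    have : (fun n => q ^+ n * complex.Re c) @ \oo --> 0 * complex.Re c.
      by apply: cvgMl; apply: cvg_expr; rewrite ger0_norm.
    rewrite mul0r => /cvgr_lt; exact.
  exists (u N); exists N => // m /= Nm; rewrite -ball_normE/=.
  rewrite -(subnKC Nm); apply: le_lt_trans (uD _ _) _.
  by rewrite cE -rmorphM ltcE/= ei eqxx.
(* For large [N], both [f p - f (u N)] and [u N.+1 - p] have norm at most [e / 2]. *)
exists p; apply/eqP; rewrite -subr_eq0 -normr_le0; apply/ler_addgt0Pl => e e0.
rewrite addr0; have e20 : 0 < e / 2 by rewrite divr_gt0.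
have /cvgrPdist_lt/(_ _ e20)[N _ hN] := up.
have -> : f p - p = (f p - f (u N)) + (u N.+1 - p) by rewrite addrA subrK.
rewrite (splitr e); apply: le_trans (ler_normD _ _) _; apply: lerD.
  apply: le_trans (fq _ _) _; apply: le_trans (ltW (hN N (leqnn N))).
  by rewrite ler_piMl// lecR ltW.
by rewrite distrC ltW//; apply: hN => /=.
Qed.

End contraction.

(** * Invertibility of coercive operators *)

Section operators.
Context {R : realType} {H : hilbertType R}.
Implicit Types T : H -> H.

Lemma linear_operatorB T : linear T -> {morph T : x y / x - y}.
Proof.
by move=> Tl x y; have := Tl (-1) y x; rewrite !scaleN1r ![- _ + _]addrC.
Qed.

Lemma bounded_operator_sqnorm T : bounded_operator T ->
  exists2 K : R, 0 <= K & forall x, sqnorm (T x) <= K * sqnorm x.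
Proof.
move=> [_ [M TM]]; exists (Num.max M 0 ^+ 2) => [|x]; first exact: sqr_ge0.
have M0 : 0 <= Num.max M 0 by rewrite le_max lexx orbT.
rewrite -norm_sqnorm_le//; apply: le_trans (TM x) _.
by rewrite ler_wpM2r// lecR le_max lexx.
Qed.

(* Lax-Milgram: if [delta] is a coercivity constant of [T] and [M] bounds the
   square of its norm, then [y |-> y - t (T y - w)] is a contraction for
   [t = delta / (M + delta ^ 2)], and its fixed point solves [T y = w]. *)
Lemma coercive_surjective T (delta : R) : bounded_operator T -> 0 < delta ->
  (forall x, delta * sqnorm x <= rinner (T x) x) ->
  forall w, exists y, T y = w.
Proof.
move=> Tb d0 Tc w; have [Tl _] := Tb.
have [M M0 TM] := bounded_operator_sqnorm T Tb.
have TB := linear_operatorB T Tl.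
pose L := M + delta ^+ 2; pose t := delta / L.
have L0 : 0 < L by rewrite ltr_wpDl// exprn_gt0.
have t0 : 0 < t by rewrite divr_gt0.
have tL : t ^+ 2 * L = t * delta.
  by rewrite /t expr2 -!mulrA mulVf ?gt_eqF// mulr1 mulrC.
have td1 : t * delta <= 1.
  by rewrite /t mulrAC ler_pdivrMr// mul1r -expr2 lerDr.
have [||p] := contraction_fixpoint (fun y => y - t%:C *: (T y - w))
  (Num.sqrt (1 - t * delta)).
- by rewrite sqrtr_ge0/= -[ltRHS]sqrtr1 ltr_sqrt// ltrBlDr ltrDl mulr_gt0.
- move=> x y; rewrite norm_sqnorm_le ?sqrtr_ge0// sqr_sqrtr ?subr_ge0//.
  have -> : x - t%:C *: (T x - w) - (y - t%:C *: (T y - w)) =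
      (x - y) - t%:C *: T (x - y).
    by rewrite TB opprD addrACA -opprD -scalerBr opprB addrA subrK.
  rewrite sqnormD sqnormN rinnerNr rinnerZr {2}/sqnorm rinnerZl rinnerZr.
  rewrite -/(sqnorm _) (rinnerC (x - y)) [t * (t * _)]mulrA -expr2.
  have := ler_wpM2l (ltW t0) (Tc (x - y)); rewrite mulrA.
  have : t ^+ 2 * sqnorm (T (x - y)) <= t * delta * sqnorm (x - y).
    rewrite -tL -mulrA ler_wpM2l ?sqr_ge0//.
    apply: le_trans (TM _) _; rewrite ler_wpM2r ?sqnorm_ge0//.
    by rewrite lerDl sqr_ge0.
  lra.
move=> /eqP; rewrite -subr_eq0 addrC addKr oppr_eq0 scaler_eq0.
rewrite -(rmorph0 (real_complex R)) (inj_eq (@complexI R)) gt_eqF//=.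
by rewrite subr_eq0 => /eqP; exists p.
Qed.

Lemma coercive_invertible T (delta : R) : bounded_operator T -> 0 < delta ->
  (forall x, delta * sqnorm x <= rinner (T x) x) -> invertible_operator T.
Proof.
move=> Tb d0 Tc; have [Tl _] := Tb.
have [S TS] := choice (coercive_surjective T delta Tb d0 Tc).
have TB := linear_operatorB T Tl.
have Tinj : injective T.
  move=> x y Txy; apply/eqP; rewrite -subr_eq0 -sqnorm_eq0.
  have := Tc (x - y); rewrite TB Txy rinnerDl rinnerNl subrr pmulr_rle0// => h.
  by rewrite eq_le h sqnorm_ge0.
have ST : cancel T S by move=> x; apply: Tinj; rewrite TS.
exists S; split=> //; split=> [a x y|].
  by apply: Tinj; rewrite Tl !TS.
(* Coercivity at [S x] and [rinner_le] with weight [delta^-1] give [delta |S x|^2 <= Re <x, S x> <=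
   (delta^-1 |x|^2 + delta |S x|^2) / 2]. *)
exists delta^-1 => x; rewrite norm_sqnorm_le; last by rewrite invr_ge0 ltW.
have := Tc (S x); rewrite TS => Sc.
have := rinner_le delta^-1 x (S x); rewrite invr_gt0 invrK => /(_ d0).
have := ler_norm (rinner x (S x)) => h1 h2.
rewrite exprVn -(ler_pM2l (exprn_gt0 2 d0)) mulrA mulfV ?mul1r; last first.
  by rewrite expf_neq0// gt_eqF.
rewrite -(ler_pM2l (_ : 0 < delta^-1)) ?invr_gt0// expr2 -mulrA mulKf ?gt_eqF//.
lra.
Qed.

End operators.

(** * Displacement of vectors by the generators *)

Section displacement.
Context {R : realType} {G : groupType} {H : hilbertType R}.
Context (pi : unitary_rep G H) {n : nat} (g : 'I_n -> G).
Implicit Types (h : G) (y : H) (z : 'rV[R[i]]_n.+1).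

(** This is [Q]; it vanishes exactly on the vectors fixed by every [g k]. *)
Definition displacement y : R := \sum_k sqnorm (pi (g k) y - y).

Lemma displacement_ge0 y : 0 <= displacement y.
Proof. by apply: sumr_ge0 => k _; exact: sqnorm_ge0. Qed.

Lemma sqnorm_rep h y : sqnorm (pi h y) = sqnorm y.
Proof. by rewrite /sqnorm /rinner; have [_ -> _] := rep_unitary pi h. Qed.

Lemma repB h x y : pi h (x - y) = pi h x - pi h y.
Proof. by have [pil _ _] := rep_unitary pi h; exact: linear_operatorB. Qed.

Lemma repZ h a y : pi h (a *: y) = a *: pi h y.
Proof.
have [pil _ _] := rep_unitary pi h.
have pi0 : pi h 0 = 0 by have := repB h 0 0; rewrite !subrr.
by have := pil a y 0; rewrite pi0 !addr0.
Qed.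

Lemma displacementZ (a : R) y :
  displacement (a%:C *: y) = a ^+ 2 * displacement y.
Proof.
rewrite /displacement mulr_sumr; apply: eq_bigr => k _.
by rewrite repZ -scalerBr /sqnorm rinnerZl rinnerZr mulrA.
Qed.

Lemma sqnorm_repB h y :
  sqnorm (pi h y - y) = 2 * (sqnorm y - rinner (pi h y) y).
Proof. by rewrite sqnormD sqnormN sqnorm_rep rinnerNr; ring. Qed.

Lemma pencil_sum0 z y : \sum_i z 0 i = 0 ->
  pencil pi g z y = \sum_k z 0 (lift ord0 k) *: (pi (g k) y - y).
Proof.
rewrite big_ord_recl /pencil => /eqP; rewrite addr_eq0 => /eqP ->.
rewrite scaleNr scaler_suml addrC -sumrB.
by apply: eq_bigr => k _; rewrite scalerBr.
Qed.

Lemma sqnorm_pencil_le z : \sum_i z 0 i = 0 ->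
  exists2 K : R, 0 <= K &
    forall y, sqnorm (pencil pi g z y) <= K * displacement y.
Proof.
move=> z0; pose w k := complex.Re (`|z 0 (lift ord0 k)| ^+ 2).
have w0 k : 0 <= w k.
  by rewrite -lecR /w RRe_real ?rpredX ?normr_real// exprn_ge0.
have K0 : 0 <= 2 ^+ n * \sum_k w k by rewrite mulr_ge0 ?exprn_ge0 ?sumr_ge0.
exists (2 ^+ n * \sum_k w k) => // y; rewrite pencil_sum0//.
apply: le_trans (sqnorm_sum_le _ _) _; rewrite -mulrA ler_pM2l ?exprn_gt0//.
rewrite mulr_sumr; apply: ler_sum => k _; rewrite sqnormZ -/(w k).
by rewrite ler_wpM2r ?sqnorm_ge0// (bigD1 k)//= lerDl sumr_ge0.
Qed.

Lemma displacement_generates : generates (range g) ->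
  forall h, exists2 C : R, 0 <= C &
    forall y, sqnorm (pi h y - y) <= C * displacement y.
Proof.
move=> gG h; pose K := [set h | exists2 C : R, 0 <= C &
  forall y, sqnorm (pi h y - y) <= C * displacement y].
suff : K h by [].
have : [set: G] h by [].
rewrite -gG; apply: smallest_sub.
  split=> [|h1 h2]; rewrite !inE/=.
    exists 0 => // y.
    by rewrite rep1 subrr mul0r /sqnorm -{1}(subrr y) rinnerDl rinnerNl subrr.
  move=> [C1 C10 hC1] [C2 C20 hC2].
  exists (2 * (C2 + C1)) => [|y]; first by rewrite mulr_ge0 ?addr_ge0.
  (* The first difference is [pi h1] applied to [pi h2^-1 y - y], which by unitarity has the same
     norm as [pi h2 y - y]. *)
  have -> : pi (h1 / h2)%g y - y =
      (pi (h1 / h2)%g y - pi h1 y) + (pi h1 y - y) by rewrite addrA subrK.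
  apply: le_trans (sqnormD_le _ _) _; rewrite -mulrA ler_pM2l// mulrDl.
  apply: lerD; last exact: hC1.
  rewrite repM -repB sqnorm_rep -(sqnorm_rep h2) repB -repM mulgV rep1.
  by rewrite -sqnormN opprB.
move=> _ [k _ <-]; exists 1 => // y; rewrite mul1r /displacement (bigD1 k)//=.
by rewrite lerDl sumr_ge0// => j _; exact: sqnorm_ge0.
Qed.

(** One almost invariant vector, rescaled to the norm of [x], already approximates the constant
    coefficient of [x]. *)
Lemma weakly_contained_trivial : generates (range g) ->
  (forall e : R, 0 < e -> exists y, displacement y < e * sqnorm y) ->
  weakly_contained (trivial_rep R G) pi.
Proof.
move=> gG pi_ai x F e /finite_seqP[s ->] e0.
have [C C0 sC] : exists2 C : R, 0 <= C & forall h, h \in s ->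
    forall y, sqnorm (pi h y - y) <= C * displacement y.
  elim: s => [|h s [C1 C10 hC1]]; first by exists 0.
  have [C2 C20 hC2] := displacement_generates gG h.
  exists (C1 + C2) => [|h']; first exact: addr_ge0.
  rewrite inE => /predU1P[->|/hC1 h'C] y; rewrite mulrDl.
    by rewrite ler_wpDl// mulr_ge0// displacement_ge0.
  by rewrite ler_wpDr// mulr_ge0// displacement_ge0.
pose r := sqnorm x; have r0 : 0 <= r by exact: sqnorm_ge0.
(* Chosen so that [t^-1 r < e / 2] and [t C d r <= e / 2], the two terms of [inner_le]; adding 1 to
   [r] and [C] covers the case where they vanish. *)
pose t := 2 * (r + 1) / e; pose d := e / (2 * t * (C + 1) * (r + 1)).
have r10 : 0 < r + 1 by rewrite ltr_wpDl.
have C10 : 0 < C + 1 by rewrite ltr_wpDl.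
have t0 : 0 < t by rewrite divr_gt0 ?mulr_gt0.
have d0 : 0 < d by rewrite divr_gt0// mulr_gt0// mulr_gt0// mulr_gt0.
have [y dy] := pi_ai d d0.
have y0 : 0 < sqnorm y.
  by rewrite -(pmulr_rgt0 _ d0) (le_lt_trans (displacement_ge0 y)).
pose y' := (Num.sqrt (r / sqnorm y))%:C *: y.
have ysqr : Num.sqrt (r / sqnorm y) ^+ 2 = r / sqnorm y.
  by rewrite sqr_sqrtr// divr_ge0// ltW.
have y'r : sqnorm y' = r.
  by rewrite /sqnorm rinnerZl rinnerZr mulrA -expr2 ysqr divfK// gt_eqF.
have y'd : displacement y' <= d * r.
  rewrite displacementZ ysqr mulrAC ler_pdivrMr// -mulrA mulrCA.
  by rewrite ler_wpM2l// ltW.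
exists 1, (fun=> y') => h /sC/(_ y') hy'; rewrite big_ord1/= inner_sqnorm -/r.
(* As [x] and [y'] have equal norms, the error is [|<pi h y' - y', y'>|]. *)
rewrite -y'r -inner_sqnorm distrC -[X in _ - X]/(inner y' y').
rewrite -innerBl.
apply: le_lt_trans (inner_le _ _ _ t0) _; rewrite ltcR y'r.
have h1 : t * sqnorm (pi h y' - y') <= e / 2.
  have : t * sqnorm (pi h y' - y') <= t * (C * (d * r)).
    by rewrite ler_pM2l// (le_trans hy')// ler_wpM2l.
  move=> /le_trans; apply.
  have -> : t * (C * (d * r)) = e / 2 * (C * r / ((C + 1) * (r + 1))).
    by rewrite /d; field; rewrite !gt_eqF.
  rewrite ler_piMr ?divr_ge0 ?(ltW e0)// ler_pdivrMr ?mulr_gt0//.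
  by rewrite mul1r ler_pM// lerDl.
have h2 : t^-1 * r < e / 2.
  have -> : t^-1 * r = e / 2 * (r / (r + 1)).
    by rewrite /t; field; rewrite !gt_eqF.
  by rewrite gtr_pMr ?divr_gt0// ltr_pdivrMr// mul1r ltrDl.
by rewrite (splitr e) ler_ltD.
Qed.

End displacement.

(** * Weak containment of the trivial representation and the hyperplane [H_0] *)

Theorem lemma5p8 (R : realType) (n : nat) (hn : (0 < n)%N)
    (G : groupType) (g : 'I_n -> G) (hg : generates (range g))
    (H : hilbertType R) (pi : unitary_rep G H) :
  weakly_contained (trivial_rep R G) pi <->
  sum0_hyperplane R n `<=` proj_spectrum (pencil pi g).
Proof.
split=> [wc _ [z [z0 [-> sz]]]|HA].
  apply/proj_spectrum_pencilP => -[S [Sb zS _]].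
  have [M M0 SM] := bounded_operator_sqnorm S Sb.
  have [K K0 zK] := sqnorm_pencil_le pi g z sz.
  (* A bounded inverse [S] would make the displacement bounded below. *)
  have yQ y : sqnorm y <= M * K * displacement pi g y.
    by rewrite -{1}(zS y) (le_trans (SM _))// -mulrA ler_wpM2l.
  (* This [e] makes [1 - e < \sum_i |y_i|^2 <= M K (4 n e)] contradictory. *)
  have [e [e0 Ke]] : exists e : R, 0 < e /\ e * (1 + M * K * (4 * n%:R)) < 1.
    have : 0 < 1 + M * K * (4 * n%:R) by rewrite ltr_pwDl// !mulr_ge0.
    move: (1 + _) => c c0; exists (2 * c)^-1; split.
      by rewrite invr_gt0 mulr_gt0.
    by rewrite invfM -mulrA mulVf ?gt_eqF// mulr1 invf_lt1// ltr1n.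
  (* The element [1%g] is included to control the total mass [\sum_i |y_i|^2]. *)
  have Ffin : finite_set ([set 1%g] `|` range g).
    by rewrite finite_setU; split => //; exact/finite_image/finite_finset.
  have [m [y hy]] := wc 1 _ _ Ffin e0.
  have {}hy h : ([set 1%g] `|` range g) h ->
      `|1 - \sum_i rinner (pi h (y i)) (y i)| < e.
    move=> /hy/normc_Re_le; rewrite inner_norm normr1 expr1n.
    have -> // : complex.Re (1 - \sum_i inner (pi h (y i)) (y i)) =
        1 - \sum_i rinner (pi h (y i)) (y i).
    by rewrite ReD ReN Re_sum.
  have hs : 1 - e < \sum_i sqnorm (y i).
    have := hy 1%g (or_introl erefl); rewrite ltr_norml => /andP[_].
    by under eq_bigr do rewrite rep1; rewrite -/sqnorm ltrBlDr ltrBlDl addrC.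
  (* Each generator contributes twice the difference of two sums that both lie within [e] of 1,
     hence at most [4 e]. *)
  have hQ : \sum_i displacement pi g (y i) <= n%:R * (4 * e).
    rewrite exchange_big/= mulr_natl -[X in _ *+ X]card_ord -sumr_const.
    apply: ler_sum => k _; under eq_bigr do rewrite sqnorm_repB.
    rewrite -mulr_sumr sumrB.
    have := hy (g k) (or_intror (imageT g k)).
    have := hy 1%g (or_introl erefl); under eq_bigr do rewrite rep1.
    rewrite -/sqnorm !ltr_norml => /andP[? ?] /andP[? ?].
    lra.
  have : \sum_i sqnorm (y i) <= M * K * (n%:R * (4 * e)).
    apply: (@le_trans _ _ (M * K * \sum_i displacement pi g (y i))).
      by rewrite mulr_sumr; apply: ler_sum => i _; exact: yQ.
    by rewrite ler_wpM2l// mulr_ge0.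
  lra.
apply: (weakly_contained_trivial pi g hg) => e e0; apply: contrapT => noy.
have {}noy y : e * sqnorm y <= displacement pi g y.
  by rewrite leNgt; apply/negP => ye; apply: noy; exists y.
pose z : 'rV[R[i]]_n.+1 := \row_i (if i == ord0 then n%:R else -1).
have z0 : z != 0.
  apply/eqP => /matrixP/(_ 0 ord0); rewrite !mxE eqxx => /eqP.
  by rewrite pnatr_eq0 -leqn0 leqNgt hn.
have sz : \sum_i z 0 i = 0.
  rewrite big_ord_recl !mxE eqxx; under eq_bigr do rewrite mxE/=.
  by rewrite sumr_const card_ord mulNrn subrr.
have /proj_spectrum_pencilP : proj_spectrum (pencil pi g) (proj_point z0).
  by apply: HA; exists z, z0.
(* The constant [e / 2] comes from [Re <A y, y> = Q y / 2] and [Q y >= e |y|^2]. *)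
apply; apply: (@coercive_invertible _ _ _ (e / 2)) => [||y].
- exact: pencil_bounded.
- by rewrite divr_gt0.
rewrite pencil_sum0// rinner_suml.
have -> : \sum_k rinner (z 0 (lift ord0 k) *: (pi (g k) y - y)) y =
    2^-1 * displacement pi g y.
  rewrite mulr_sumr; apply: eq_bigr => k _.
  by rewrite mxE/= scaleN1r sqnorm_repB rinnerNl rinnerDl rinnerNl; field.
by have := noy y; lra.
Qed.
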